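(* Let $m\ge 2$ be an integer. Then the sequence of integers $\{t_m(n)\}_{n=0}^{\infty}$ defined by the power series expansion $\prod_{i=0}^{\infty}(1-x^{2^i})^m=\sum_{n=0}^{\infty}t_m(n)x^n$ is unbounded.
   Context: For an integer $m$, $t_m(n)$ denotes the coefficient of $x^n$ in the power series $F_m(x)=\prod_{i=0}^{\infty}(1-x^{2^i})^m=\sum_{n=0}^{\infty}t_m(n)x^n\in\mathbb{Z}[[x]]$. A sequence of integers $\{t(n)\}_{n=0}^\infty$ is unbounded if there is no real constant $C$ with $|t(n)|\le C$ for all $n\ge 0$. *)

(* Defs.v *)
From HB Require Import structures.
From mathcomp Require Import all_boot all_order all_algebra.
From mathcomp Require Import reals.

Set Implicit Arguments.
Unset Strict Implicit.
Unset Printing Implicit Defensive.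

Import Order.TTheory GRing.Theory Num.Theory.

Local Open Scope ring_scope.

(* A power series in Z[[x]] is its coefficient sequence nat -> int. The
   sequence of polynomials P converges to f in the x-adic topology when each
   coefficient is eventually constant, with the corresponding value of f. *)
Definition xadic_cvg (P : nat -> {poly int}) (f : nat -> int) : Prop :=
  forall n : nat, exists N0 : nat, forall N : nat, (N0 <= N)%N -> (P N)`_n = f n.

Definition partial_prod (m N : nat) : {poly int} :=
  \prod_(i < N) (1 - 'X^(2 ^ i)) ^+ m.

(* \prod_(i >= 0) (1 - x^(2^i))^m = \sum_n t n x^n in Z[[x]] *)
Definition is_expansion (m : nat) (t : nat -> int) : Prop :=
  xadic_cvg (partial_prod m) t.

Definition unbounded (R : realType) (t : nat -> int) : Prop :=
  ~ exists C : R, forall n : nat, `|(t n)%:~R| <= C.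

(* For every m exactly one sequence satisfies is_expansion m. *)
Lemma is_expansion_unique (m : nat) (t u : nat -> int) :
  is_expansion m t -> is_expansion m u -> t =1 u.
Proof.
move=> ht hu n; have [N1 h1] := ht n; have [N2 h2] := hu n.
by rewrite -(h1 (maxn N1 N2)) ?leq_maxl // (h2 (maxn N1 N2)) ?leq_maxr.
Qed.

Lemma coef_mul_1subXn_exp (p : {poly int}) (k m n : nat) :
  (n < k)%N -> (p * (1 - 'X^k) ^+ m)`_n = p`_n.
Proof.
move=> nk; elim: m => [|m IH]; first by rewrite expr0 mulr1.
by rewrite exprSr mulrA mulrBr mulr1 coefB coefMXn nk subr0.
Qed.

Lemma is_expansion_exists (m : nat) :
  is_expansion m (fun n => (partial_prod m n)`_n).
Proof.
move=> n; exists n => N /subnK <-; elim: (N - n)%N => [//|d IH].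
rewrite addSn /partial_prod big_ord_recr /= coef_mul_1subXn_exp //.
by apply: leq_ltn_trans (leq_addl d n) _; apply: ltn_expl.
Qed.

(* Main.v *)
Require Import Defs.
From mathcomp Require Import all_boot all_order all_algebra.
From mathcomp Require Import reals.
From mathcomp Require Import all_field zify ring.

(** Write [P_N] for [partial_prod m N], the [m]-th power of the product of the
    [1 - x^(2^i)] with [i < N].  The growth of [P_N] at a cube root of unity is
    incompatible with bounded coefficients.

    Lower bound.  Let [w] be a primitive cube root of unity.  Squaring
    exchanges [w] and [w^2], and [(1 - w)(1 - w^2) = 3]; so each [i] contributes
    [3^m] to the product [P_N(w) P_N(w^2)], which equals [3^(N m)]
    ([partial_prod_cube_root]).  This is at least [9^N] when [m >= 2].

    Upper bound.  Suppose that [t] is bounded.  The coefficients of [P_N] agree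
    with [t] only below [2^N], while the degree of [P_N] is about [m 2^N].  They
    are nevertheless bounded independently of [N]: the whole series is [P_N(x)]
    times a copy of itself in the variable [x^(2^N)], and only about [m] terms
    of that copy matter in the degrees concerned.  Dividing by them amounts to
    multiplying by [S(x^(2^N))] for a polynomial [S] that depends on [m] alone,
    which enlarges coefficients at most by the sum of the absolute values of
    the coefficients of [S] ([partial_prod_coef_bounded]).  Hence
    [|P_N(z)| <= E 2^N] on the unit circle, with [E] independent of [N]
    ([norm_partial_prod_circle]).

    Together, [9^N <= E^2 4^N] for every [N], which is absurd. *)

Set Implicit Arguments.
Unset Strict Implicit.
Unset Printing Implicit Defensive.

Import Order.TTheory GRing.Theory Num.Theory.

Local Open Scope ring_scope.

Lemma partial_prodD (m N L : nat) :
  partial_prod m (N + L) =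
  partial_prod m N * (partial_prod m L \Po 'X^(2 ^ N)).
Proof.
rewrite /partial_prod big_split_ord /= rmorph_prod; congr (_ * _).
apply: eq_bigr => i _.
by rewrite rmorphXn /= rmorphB /= comp_polyC comp_Xn_poly -exprM expnD.
Qed.

(** The factors from the [N]-th on only alter coefficients in degrees at least
    [2 ^ N]. *)
Lemma coef_partial_prod (m : nat) (t : nat -> int) (N n : nat) :
  is_expansion m t -> (n < 2 ^ N)%N -> (partial_prod m N)`_n = t n.
Proof.
move=> ht ltn; have [N0 hN0] := ht n.
rewrite -(hN0 (N + N0)%N) ?leq_addl //.
elim: N0 {hN0} => [|k IHk]; first by rewrite addn0.
rewrite addnS IHk /partial_prod big_ord_recr /= coef_mul_1subXn_exp //.
by rewrite (leq_trans ltn) // leq_pexp2l // leq_addr.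
Qed.

(** This is the degree bound [m * (2 ^ N - 1)], arranged to avoid truncated
    subtraction. *)
Lemma size_partial_prod (m N : nat) :
  (size (partial_prod m N) + m <= (m * 2 ^ N).+1)%N.
Proof.
elim: N => [|N IHN].
  by rewrite /partial_prod big_ord0 size_poly1 muln1 add1n.
rewrite /partial_prod big_ord_recr /= -/(partial_prod m N) expnS mulnCA.
have size_fac : (size ((1 - 'X^(2 ^ N)) ^+ m : {poly int}) <= (m * 2 ^ N).+1)%N.
  apply: leq_trans (size_poly_exp_leq _ _) _.
  rewrite ltnS mulnC leq_mul2l; apply/orP; right.
  rewrite -subn1 leq_subLR add1n; apply: leq_trans (size_polyD _ _) _.
  by rewrite geq_max size_poly1 size_polyN size_polyXn leqnn.
apply: leq_trans (leq_add (size_polyMleq _ _) (leqnn m)) _.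
move: IHN size_fac; move: (size _) (size _) => a b; lia.
Qed.

Lemma size_partial_prod_le (m N : nat) :
  (size (partial_prod m N) <= m.+1 * 2 ^ N)%N.
Proof.
apply: leq_trans (leq_addr m _) (leq_trans (size_partial_prod m N) _).
by rewrite mulSn -add1n leq_add2r expn_gt0.
Qed.

(** A power series with constant term 1 is invertible.  The polynomial form
    comes from writing [p = 1 - u 'X] and summing the geometric series up to
    the exponent [k - 1]. *)
Lemma poly_inverse_mod_Xn (A : comNzRingType) (p : {poly A}) (k : nat) :
  p`_0 = 1 -> exists s r : {poly A}, p * s = 1 - 'X^k * r.
Proof.
move=> p0; pose u := - drop_poly 1 p.
have Dp : p = 1 - u * 'X.
  rewrite -[LHS](poly_take_drop 1) expr1 mulNr opprK; congr (_ + _).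
  by apply/polyP=> -[|i]; rewrite coef_take_poly coef1 ?p0.
exists (\sum_(i < k) (u * 'X) ^+ i), (u ^+ k).
by rewrite {1}Dp [in RHS]mulrC -exprMn -opprB mulNr -subrX1 opprB.
Qed.

(** The inverse [s] of [partial_prod m m] is taken modulo ['X^(m.+1)], so that
    after the substitution of ['X^(2 ^ N)] the error term starts beyond the
    degree of [partial_prod m N].  Multiplying [partial_prod m (N + m)] by
    [s('X^(2 ^ N))] then recovers [partial_prod m N], and [N + m] is large
    enough for the coefficients involved to be values of [t]. *)
Lemma partial_prod_coef_bounded (m : nat) (t : nat -> int) (B : int) :
    is_expansion m t -> (forall n, `|t n| <= B) ->
  exists D : int, forall N n, `|(partial_prod m N)`_n| <= D.
Proof.
move=> ht tB.
have B_ge0 : 0 <= B := le_trans (normr_ge0 _) (tB 0).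
have P0 : (partial_prod m m)`_0 = 1.
  rewrite (coef_partial_prod ht) ?expn_gt0 //.
  by rewrite -(@coef_partial_prod _ _ 0 0 ht) // /partial_prod big_ord0 coef1.
have [s [r Dsr]] := poly_inverse_mod_Xn m.+1 P0.
exists (\sum_(j < size s) `|s`_j| * B) => N n.
have D_ge0 : 0 <= \sum_(j < size s) `|s`_j| * B.
  by apply: sumr_ge0 => j _; apply: mulr_ge0.
have [n_large|n_small] := leqP (m.+1 * 2 ^ N) n.
  rewrite nth_default ?normr0 //.
  exact: leq_trans (size_partial_prod_le m N) n_large.
(* Below degree (m + 1) 2^N, the error term of the inverse is invisible. *)
have -> : (partial_prod m N)`_n =
    (partial_prod m (N + m) * (s \Po 'X^(2 ^ N)))`_n.
  rewrite partial_prodD -mulrA -rmorphM /= Dsr rmorphB rmorphM /=.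
  rewrite comp_polyC comp_Xn_poly -exprM mulrBr mulr1 coefB mulrCA coefXnM.
  by rewrite mulnC n_small subr0.
rewrite comp_polyE mulr_sumr coef_sum.
apply: le_trans (ler_norm_sum _ _ _) _; apply: ler_sum => j _.
rewrite -scalerAr coefZ normrM ler_wpM2l // -exprM coefMXn.
case: ifP => _; first by rewrite normr0.
(* The degrees stay below (m + 1) 2^N, hence below 2^(N + m). *)
rewrite (coef_partial_prod ht) //; apply: leq_ltn_trans (leq_subr _ _) _.
apply: leq_trans n_small _.
by rewrite expnD mulnC leq_mul2l ltn_expl // orbT.
Qed.

Lemma norm_partial_prod_circle (m : nat) (D : int) :
    (forall N n, `|(partial_prod m N)`_n| <= D) ->
  exists E : nat, forall (N : nat) (z : algC), `|z| = 1 ->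
    `|(map_poly intr (partial_prod m N)).[z]| <= (E * 2 ^ N)%:R.
Proof.
move=> PD; have D_ge0 : 0 <= D := le_trans (normr_ge0 _) (PD 0 0).
exists (`|D| * m.+1)%N => N z z1.
rewrite (@horner_coef_wide _ (m.+1 * 2 ^ N)); last first.
  exact: leq_trans (size_poly _ _) (size_partial_prod_le m N).
apply: le_trans (ler_norm_sum _ _ _) _.
apply: (@le_trans _ _ (\sum_(i < m.+1 * 2 ^ N) (`|D|%N)%:R)).
  apply: ler_sum => i _; rewrite normrM normrX z1 expr1n mulr1 coef_map /=.
  by rewrite -intr_norm pmulrn ler_int gez0_abs.
by rewrite sumr_const card_ord -mulrnA mulnA.
Qed.

(** If [y ^+ 2 + y + 1 = 0] then [y ^+ 2] satisfies the same equation and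
    [(1 - y)(1 - y ^+ 2) = 3]; this applies to every [y = w ^+ (2 ^ i)]. *)
Lemma partial_prod_cube_root (m N : nat) (w : algC) :
    w ^+ 2 + w + 1 = 0 ->
  (map_poly intr (partial_prod m N)).[w] *
  (map_poly intr (partial_prod m N)).[w ^+ 2] = (3 ^ (N * m))%:R.
Proof.
move=> w0; rewrite /partial_prod !rmorph_prod !horner_prod -big_split /=.
rewrite (eq_bigr (fun=> (3 ^ m)%:R)) => [|i _].
  by rewrite prodr_const card_ord -natrX -expnM mulnC.
rewrite !rmorphXn /= !rmorphB /= rmorph1 !map_polyXn !hornerE.
rewrite -exprMn -exprM mulnC natrX; congr (_ ^+ _).
have : (w ^+ (2 ^ i)) ^+ 2 + w ^+ (2 ^ i) + 1 = 0.
  elim: (i : nat) => [|k IHk]; first by rewrite expr1.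
  rewrite expnS mulnC exprM; move: (w ^+ _) IHk => y y0.
  by rewrite -(mulr0 (y ^+ 2 - y + 1)) -y0; ring.
rewrite exprM; move: (w ^+ _) => y y0.
by rewrite -[RHS]addr0 -(mulr0 (y - 2)) -y0; ring.
Qed.

Theorem theorem1p2 (R : realType) (m : nat) (hm : (2 <= m)%N)
    (t : nat -> int) (ht : is_expansion m t) :
  unbounded R t.
Proof.
case=> C tC.
have tB n : `|t n| <= (Num.bound C)%:Z.
  rewrite -(ler_int R) intr_norm (le_trans (tC n)) // ltW //.
  exact: archi_boundP (le_trans (normr_ge0 _) (tC 0)).
have [D PD] := partial_prod_coef_bounded ht tB.
have [E PE] := norm_partial_prod_circle PD.
have [w w_prim] := C_prim_root_exists (isT : (0 < 3)%N).
have w3 : w ^+ 3 = 1 := prim_expr_order w_prim.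
have w1 : `|w| = 1.
  by apply/eqP; rewrite -(pexpr_eq1 (n := 3)) // -normrX w3 normr1.
have w0 : w ^+ 2 + w + 1 = 0.
  apply: (mulfI (x := w - 1)); last first.
    by apply: etrans (_ : w ^+ 3 - 1 = _); [ring | rewrite w3 subrr mulr0].
  by rewrite subr_eq0 -(prim_order_dvd w_prim 1).
have pow_le N : (9 ^ N <= E * E * 4 ^ N)%N.
  have -> : (E * E * 4 ^ N = (E * 2 ^ N) * (E * 2 ^ N))%N.
    by rewrite mulnACA -expnMn.
  apply: (@leq_trans (3 ^ (N * m))).
    by rewrite -[9%N]/(3 ^ 2)%N -expnM mulnC leq_pexp2l // leq_mul2l hm orbT.
  rewrite -(ler_nat algC) -[leLHS]ger0_norm // -(partial_prod_cube_root m N w0).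
  rewrite normrM natrM; apply: ler_pM; rewrite ?normr_ge0 ?PE ?normrX ?w1 ?expr1n //.
(* At N = E^2 + 1 the bound fails: E^2 < 2^N and 2^N 4^N = 8^N <= 9^N. *)
have := pow_le (E * E).+1; rewrite leqNgt => /negP; apply.
apply: (@leq_trans (8 ^ (E * E).+1)); last by rewrite leq_exp2r.
rewrite -[8%N]/(2 * 4)%N expnMn ltn_mul2r expn_gt0 /=.
exact: ltnW (ltn_expl _ _).
Qed.
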